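(* Let $G = \{\ell_1 < \ell_2 < \cdots < \ell_g\}$ be a pure $\kappa$-sparse gapset with genus $g \geq 2$ such that $2g \leq 3\kappa$. If $G \neq \{1,3,5\}$, then there is a unique $i \in \{1,\dots,g-1\}$ such that $\ell_{i+1} - \ell_i = \kappa$; for $G = \{1,3,5\}$ (where $g=3$, $\kappa=2$) such an $i$ is not unique.
   Context: $\mathbb{N}$ denotes the positive integers. A gapset is a finite set $G \subset \mathbb{N}$ such that whenever $z \in G$ and $z = x+y$ with $x,y \in \mathbb{N}$, then $x \in G$ or $y \in G$. The genus of $G$ is its cardinality. A gapset $G = \{\ell_1 < \cdots < \ell_g\}$ of genus $g \geq 2$ is pure $\kappa$-sparse if $\ell_{i+1}-\ell_i \leq \kappa$ for all $i \in \{1,\dots,g-1\}$ and $\ell_{i+1}-\ell_i = \kappa$ for some $i$. *)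

(* Defs.v *)
From mathcomp Require Import all_boot finmap.
Set Implicit Arguments.
Unset Strict Implicit.
Unset Printing Implicit Defensive.

(* [nat] contains 0 whereas gapsets live in the positive integers: hence
   [0 \notin G] and the positivity of both summands. *)
Definition is_gapset (G : {fset nat}) : Prop :=
  0 \notin G /\
  forall x y : nat, 0 < x -> 0 < y -> x + y \in G -> x \in G \/ y \in G.

Definition genus (G : {fset nat}) : nat := #|` G|%fset.

(* The i-th smallest element of [G], with 1-based indexing, so that
   G = {ell G 1 < ... < ell G (genus G)}; meaningful for 1 <= i <= genus G. *)
Definition ell (G : {fset nat}) (i : nat) : nat :=
  nth 0 (sort leq (enum_fset G)) i.-1.

Definition gap_at (kappa : nat) (G : {fset nat}) (i : nat) : Prop :=
  1 <= i <= genus G - 1 /\ ell G i.+1 - ell G i = kappa.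

Definition pure_sparse (kappa : nat) (G : {fset nat}) : Prop :=
  (forall i : nat, 1 <= i <= genus G - 1 -> ell G i.+1 - ell G i <= kappa) /\
  exists i : nat, gap_at kappa G i.

Definition pure_sparse_gapset (kappa : nat) (G : {fset nat}) : Prop :=
  [/\ is_gapset G, 2 <= genus G & pure_sparse kappa G].

(* Main.v *)
(** Let [a < b] be the left ends of two gaps of length [k], and [z = b + k].
    Pairing [x] with [z - x] shows [z < 2 g <= 3 k]. The sums of two, resp.
    three, elements of the run [a + 1, ..., a + k - 1] of non-elements of [G]
    are again non-elements, and they fill whole intervals that [z] must avoid.
    These inequalities leave only [k = 2], [a = 1], [b = 3]. *)
Require Import Defs.
From mathcomp Require Import all_boot finmap zify.

Lemma gapset_pos (G : {fset nat}) (x : nat) : is_gapset G -> x \in G -> 0 < x.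
Proof. by case=> G0 _; case: x => // xG; rewrite xG in G0. Qed.

(** Contrapositive of the gapset axiom: the complement of [G] is a numerical semigroup. *)
Lemma gapset_notinD (G : {fset nat}) (x y : nat) : is_gapset G ->
  0 < x -> 0 < y -> x \notin G -> y \notin G -> x + y \notin G.
Proof.
move=> [_ gG] x0 y0 xG yG; apply/negP => /(gG _ _ x0 y0).
by case=> [/(negP xG)|/(negP yG)].
Qed.

Lemma gapset_lt_double_genus (G : {fset nat}) (z : nat) :
  is_gapset G -> z \in G -> z < 2 * genus G.
Proof.
move=> gG zG.
(* For [0 < x < z], one of [x], [z - x] lies in [G], so [t] covers [1, ..., z]. Dropping [z], whose
   mirror image is 0, leaves [t] of length [2 * genus G - 1], which makes the bound strict. *)
set t := enum_fset G ++ [seq z - x | x <- rem z (enum_fset G)].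
have Gz : 0 < size (enum_fset G).
  by apply: (@leq_ltn_trans (index z (enum_fset G))); rewrite ?index_mem.
suff : size (iota 1 z) <= size t.
  rewrite size_iota size_cat size_map size_rem // /genus.
  by move: Gz; case: #|` G|%fset => // n _; lia.
apply: uniq_leq_size => [|x]; first exact: iota_uniq.
rewrite mem_iota mem_cat => /andP[x0 xz].
have [-> //|xnz] := eqVneq x z; first by rewrite zG.
have xlt : x < z by lia.
case: (gG.2 x (z - x)); rewrite ?subn_gt0 ?subnKC ?(ltnW xlt) //.
  by move=> ->.
move=> zxG; apply/orP; right; apply/mapP; exists (z - x); last by lia.
by rewrite mem_rem_uniq ?fset_uniq // inE zxG andbT; lia.
Qed.

Lemma sum_of_interval lo1 hi1 lo2 hi2 z : lo1 <= hi1 -> lo2 <= hi2 ->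
  lo1 + lo2 <= z <= hi1 + hi2 ->
  exists x y, [/\ lo1 <= x <= hi1, lo2 <= y <= hi2 & z = x + y].
Proof.
(* Raise [x] first, with [y = lo2]; once [x] has reached [hi1], raise [y]. *)
move=> h1 h2 hz; have [h|h] := leqP z (hi1 + lo2).
  by exists (z - lo2), lo2; split; lia.
by exists hi1, (z - hi1); split; lia.
Qed.

Lemma gapset_notin_sum_interval (G : {fset nat}) (lo1 hi1 lo2 hi2 : nat) :
  is_gapset G -> 0 < lo1 <= hi1 -> 0 < lo2 <= hi2 ->
  (forall x, lo1 <= x <= hi1 -> x \notin G) ->
  (forall x, lo2 <= x <= hi2 -> x \notin G) ->
  forall z, lo1 + lo2 <= z <= hi1 + hi2 -> z \notin G.
Proof.
move=> gG /andP[l1 h1] /andP[l2 h2] n1 n2 z hz.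
have [x [y [hx hy ->]]] := sum_of_interval _ _ _ _ _ h1 h2 hz.
by apply: gapset_notinD; rewrite ?(n1 x) ?(n2 y) //; lia.
Qed.

Lemma ell_sorted (G : {fset nat}) : sorted ltn (sort leq (enum_fset G)).
Proof.
by rewrite ltn_sorted_uniq_leq sort_uniq fset_uniq (sort_sorted leq_total).
Qed.

Lemma size_sort_genus (G : {fset nat}) :
  size (sort leq (enum_fset G)) = genus G.
Proof. by rewrite size_sort. Qed.

Lemma ell_in (G : {fset nat}) i : 1 <= i <= genus G -> ell G i \in G.
Proof.
move=> hi; rewrite /ell -[_ \in G](mem_sort leq) mem_nth // size_sort_genus.
by lia.
Qed.

Lemma ell_inP (G : {fset nat}) (x : nat) : x \in G ->
  exists2 i, 1 <= i <= genus G & x = ell G i.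
Proof.
rewrite -[x \in G](mem_sort leq) => xs.
exists (index x (sort leq (enum_fset G))).+1; last by rewrite /ell nth_index.
by move: xs; rewrite -index_mem size_sort_genus.
Qed.

Lemma ell_lt (G : {fset nat}) i j :
  1 <= i -> i < j <= genus G -> ell G i < ell G j.
Proof.
move=> i1 /andP[ij jg]; rewrite /ell.
apply: (sorted_ltn_nth ltn_trans 0 (ell_sorted G)); last by lia.
all: by rewrite inE size_sort_genus; lia.
Qed.

Lemma ell_le (G : {fset nat}) i j :
  1 <= i -> i <= j <= genus G -> ell G i <= ell G j.
Proof.
move=> i1 /andP[]; rewrite leq_eqVlt => /predU1P[-> //|ij] jg.
by rewrite ltnW // ell_lt // ij.
Qed.

Lemma ell_between_notin (G : {fset nat}) i x : 1 <= i <= genus G - 1 ->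
  ell G i < x < ell G i.+1 -> x \notin G.
Proof.
move=> hi hx; apply/negP => /ell_inP[j hj xj]; subst x.
have [ji|ij] := leqP j i.
  have : ell G j <= ell G i by apply: ell_le; lia.
  lia.
have : ell G i.+1 <= ell G j by apply: ell_le; lia.
lia.
Qed.

Lemma gapset_two_runs (G : {fset nat}) (a b k : nat) :
  is_gapset G -> 1 < k -> 2 * genus G <= 3 * k ->
  a \in G -> b + k \in G -> a + k <= b ->
  (forall x, a < x < a + k -> x \notin G) ->
  [/\ k = 2, a = 1 & b = 3].
Proof.
move=> gG k1 gk aG zG ab run.
have a0 := gapset_pos _ _ gG aG.
have zlt := gapset_lt_double_genus _ _ gG zG.
have run1 x : a.+1 <= x <= a + k - 1 -> x \notin G.
  by move=> hx; apply: run; lia.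
have run2 := gapset_notin_sum_interval G (a.+1) (a + k - 1) (a.+1) (a + k - 1)
  gG ltac:(lia) ltac:(lia) run1 run1.
have run3 := gapset_notin_sum_interval G (a.+1) (a + k - 1) (a.+1 + a.+1)
  (a + k - 1 + (a + k - 1))
  gG ltac:(lia) ltac:(lia) run1 run2.
have z2 := contraTN (run2 (b + k)) zG.
have z3 := contraTN (run3 (b + k)) zG.
(* Write [z = b + k]. From [a + 2k <= z <= 3k - 1] follows [a <= k - 1], so [z] is not below the
   interval of double sums; as [a >= 1], it is not above that of triple sums. Hence
   [2a + 2k - 1 <= z <= 3a + 2], so [2k - 3 <= a <= k - 1]. This forces [k = 2], [a = 1],
   [z = 5]. *)
by split; lia.
Qed.

Lemma sort135 : sort leq (enum_fset [fset 1; 3; 5]%fset) = [:: 1; 3; 5].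
Proof.
(* Instead of evaluating the enumeration of the set: a strictly increasing list is determined by its
   members. *)
apply: (irr_sorted_eq ltn_trans ltnn) => // [|x]; first exact: ell_sorted.
by rewrite mem_sort -[_ \in enum_fset _]/(x \in [fset 1; 3; 5]%fset) !inE -orbA.
Qed.

Lemma genus135 : genus [fset 1; 3; 5]%fset = 3.
Proof. by rewrite -size_sort_genus sort135. Qed.

Lemma gap_at_pair (G : {fset nat}) k i j :
  is_gapset G -> 2 <= genus G -> 2 * genus G <= 3 * k ->
  gap_at k G i -> gap_at k G j -> i < j -> G = [fset 1; 3; 5]%fset.
Proof.
move=> gG g2 gk [hi di] [hj dj] ij.
have li : ell G i < ell G i.+1 by apply: ell_lt; lia.
have lj : ell G j < ell G j.+1 by apply: ell_lt; lia.
have lij : ell G i.+1 <= ell G j by apply: ell_le; lia.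
have ei : ell G i + k = ell G i.+1 by lia.
have ej : ell G j + k = ell G j.+1 by lia.
have iG : ell G i \in G by apply: ell_in; lia.
have jG : ell G j \in G by apply: ell_in; lia.
have zG : ell G j + k \in G by rewrite ej; apply: ell_in; lia.
have [||x hx|k2 a1 b3] := gapset_two_runs G (ell G i) (ell G j) k gG _ gk iG zG.
(* [1 < k] because [4 <= 2 * genus G <= 3 * k]. *)
- lia.
- by rewrite ei.
- by apply: (ell_between_notin G i); rewrite -?ei.
rewrite k2 a1 b3 in gk iG jG zG.
(* [G] contains 1, 3 and 5, and [2 * genus G <= 6] leaves no room for a fourth element. *)
apply/esym/eqP; rewrite eqEfcard; apply/andP; split.
  apply/fsubsetP => x; rewrite !inE -orbA => /or3P[] /eqP->;
    [exact: iG|exact: jG|exact: zG].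
by rewrite -!/(genus _) genus135; lia.
Qed.

(** Serves twice: it determines [kappa] for this set, and it supplies the two indices that refute
    uniqueness. *)
Lemma gap_at135 k i :
  gap_at k [fset 1; 3; 5]%fset i <-> (i = 1 \/ i = 2) /\ k = 2.
Proof.
rewrite /gap_at genus135 /ell sort135; split.
  by case: i => [|[|[|i]]] [] //= _ <-; split=> //; [left|right].
by case=> [[->|->] ->].
Qed.

Lemma gapset135 : is_gapset [fset 1; 3; 5]%fset.
Proof.
split=> [|x y x0 y0]; rewrite !inE // => h.
apply/orP; lia.
Qed.

Lemma pure_sparse135 k : pure_sparse k [fset 1; 3; 5]%fset <-> k = 2.
Proof.
split=> [[_ [i /gap_at135[]]] //|->]; split; last first.
  by exists 1; apply/gap_at135; split; first left.
move=> i; rewrite genus135 /ell sort135.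
by case: i => [|[|[|i]]].
Qed.

Theorem proposition3p12 :
  (forall (G : {fset nat}) (kappa : nat),
      pure_sparse_gapset kappa G ->
      2 * genus G <= 3 * kappa ->
      G <> [fset 1; 3; 5]%fset ->
      exists! i : nat, gap_at kappa G i)
  /\
  [/\ genus [fset 1; 3; 5]%fset = 3,
      forall kappa : nat,
        pure_sparse_gapset kappa [fset 1; 3; 5]%fset <-> kappa = 2 &
      ~ (exists! i : nat, gap_at 2 [fset 1; 3; 5]%fset i)].
Proof.
split=> [G k [gG g2 [_ [i hi]]] gk nG|].
  exists i; split=> // j hj.
  by case: (ltngtP i j) => // ij; case: nG;
    [apply: (gap_at_pair G k i j)|apply: (gap_at_pair G k j i)].
split; first exact: genus135.
  move=> k; split=> [[_ _ /pure_sparse135] //|k2].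
  by split; [exact: gapset135|rewrite genus135|apply/pure_sparse135].
move=> [i [_ iP]].
have i1 : i = 1 by apply: iP; apply/gap_at135; split; first left.
have : i = 2 by apply: iP; apply/gap_at135; split; first right.
by rewrite i1.
Qed.
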